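(* Let $R$ be a subgraph of a graph $G$. Given an oracle that solves the weighted minimum set covering (WMSC) problems $$\bigl(\{1,\dots,|\mathcal{S}_R|\},\ \{J_1,\dots,J_{|\mathcal{C}|}\},\ i\mapsto\gamma^{-\Delta\rho(c_i)}\bigr)$$ for given values of $\gamma$, the smallest branching complexity $\gamma$ of a branching rule for $R$, i.e. the optimal value of $$\min_{\gamma,\boldsymbol{x}}\gamma\quad\text{s.t.}\quad \sum_{i=1}^{|\mathcal{C}|}\gamma^{-\Delta\rho(c_i)}x_i=1,\qquad \bigcup_{i:\,x_i=1}J_i=\{1,\dots,|\mathcal{S}_R|\},\qquad \boldsymbol{x}\in\{0,1\}^{|\mathcal{C}|},\ \gamma\ge 1,$$ can be approximated to precision $\epsilon$ in time $O(\log(\epsilon^{-1}))$.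
   Context: Graphs are finite, simple and undirected. A subgraph $R\subseteq G$ is given by its vertex set $V(R)$, edge set $E(R)$, and the set $\partial R\subseteq V(R)$ of boundary vertices (those connected to the rest of $G$). A subset of a vertex set is represented by a bit string (configuration) $\boldsymbol{s}$, with $s_v=1$ iff $v$ is in the subset; $T(\boldsymbol{s})=\{v: s_v=1\}$. $N(S)$ is the set of vertices outside $S$ adjacent to some vertex of $S$. $\alpha$-tensor: for $\boldsymbol{s}_{\partial R}\in\{0,1\}^{|\partial R|}$, $\alpha(R)_{\boldsymbol{s}_{\partial R}}$ is the size of the largest independent set of $R$ restricting to $\boldsymbol{s}_{\partial R}$ on $\partial R$ ($-\infty$ if $\boldsymbol{s}_{\partial R}$ violates the independent set constraint). A boundary configuration $\boldsymbol{t}$ is irrelevant if $\alpha(R)_{\boldsymbol{t}}=-\infty$ or there is $\boldsymbol{s}\ne\boldsymbol{t}$ with $s_i\le t_i$ for all $i$ and $\alpha(R)_{\boldsymbol{s}}\ge\alpha(R)_{\boldsymbol{t}}$. The reduced $\alpha$-tensor $\tilde\alpha(R)$ is $\alpha(R)$ with all irrelevant entries set to $-\infty$. Boundary-grouped MISs: $\mathcal{S}_R=\{S_1,\dots,S_{|\mathcal{S}_R|}\}$ is the collection of sets $S_{\boldsymbol{s}_{\partial R}}$, one for each $\boldsymbol{s}_{\partial R}$ with $\tilde\alpha(R)_{\boldsymbol{s}_{\partial R}}\neq-\infty$, where $S_{\boldsymbol{s}_{\partial R}}$ consists of the configurations on $V(R)$ that are independent sets of $R$, restrict to $\boldsymbol{s}_{\partial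 R}$ on $\partial R$, and have size $\tilde\alpha(R)_{\boldsymbol{s}_{\partial R}}$. Clauses: a clause $c$ is a conjunction of literals $v$ or $\neg v$ with $v\in V(R)$; $V(c)$ is the set of vertices occurring in $c$ and $T(c)$ the set of those occurring positively. A branching rule is a disjunction (DNF) of clauses; it is valid if every $S\in\mathcal{S}_R$ contains a configuration satisfying it (written $S\vdash\mathcal{D}$). For a complexity measure $\rho$ on graphs (e.g. $\rho(G)=|V(G)|$ or $\rho(G)=\sum_{v}\max\{0,|N(v)|-2\}$), $\Delta\rho(c)=\rho(G)-\rho(G\setminus(V(c)\cup N(T(c))))$, and the branching complexity of $\mathcal{D}=c_1\lor\dots\lor c_m$ is the $\gamma\ge1$ with $\gamma^{\rho(G)}=\sum_{i}\gamma^{\rho(G)-\Delta\rho(c_i)}$. Candidate clauses: $\mathcal{C}=\{c_1,\dots,c_{|\mathcal{C}|}\}$ is the smallest set of non-empty clauses that contains, for each configuration $\boldsymbol{s}$ in each $S\in\mathcal{S}_R$, the full clause $\bigwedge_{v\in V(R)}(v\text{ if }s_v=1\text{ else }\neg v)$, and that is closed under taking the conjunction of the common literals of a clause in $\mathcal{C}$ and such a full clause, whenever this is non-empty. Put $J_i=\{j : S_j\vdash c_i\}$, i.e. the indices $j$ such that some configuration in $S_j$ satisfies $c_i$. The vector $\boldsymbol{x}\in\{0,1\}^{|\mathcal{C}|}$ encodes the branching rule that is the disjunction of the $c_i$ with $x_i=1$. WMSC: given a set $U$, a collection of subsets of $U$, and non-negative weights on these subsets, find a subcollection covering $U$ of minimum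 total weight. An oracle call is counted as constant time.
   Formalization: The program is assumed feasible (else there is no minimum); that its optimum is the smallest complexity over all valid rules with non-empty clauses is claimed only for measures that do not increase under vertex deletion, as it fails otherwise; the approximation holds for every measure. *)

(* Defs.v *)
From HB Require Import structures.
From mathcomp Require Import all_boot all_order all_algebra.
From mathcomp Require Import all_classical all_reals all_analysis.
From mathcomp Require Import finset.
Set Implicit Arguments.
Unset Strict Implicit.
Unset Printing Implicit Defensive.
Import Order.TTheory GRing.Theory Num.Theory.
Import numFieldNormedType.Exports.

Local Open Scope ring_scope.

Record sgraph := SGraph {
  vertex :> finType;
  adj : rel vertex;
  adj_sym : symmetric adj;
  adj_irr : irreflexive adj }.

Section Graph.
Variable G : sgraph.

Definition neighbourhood (S : {set G}) : {set G} :=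
  [set v | (v \notin S) && [exists u in S, adj u v]].

Definition kept (W : {set G}) : finType := {v : G | v \notin W}.

Definition kept_adj (W : {set G}) : rel (kept W) :=
  fun u v => adj (val u) (val v).

Lemma kept_adj_sym (W : {set G}) : symmetric (@kept_adj W).
Proof. by move=> u v; exact: adj_sym. Qed.

Lemma kept_adj_irr (W : {set G}) : irreflexive (@kept_adj W).
Proof. by move=> u; exact: adj_irr. Qed.

Definition delete (W : {set G}) : sgraph :=
  SGraph (@kept_adj_sym W) (@kept_adj_irr W).

(* Not necessarily induced: an edge of [G] between two vertices of the
   subgraph may be missing from it. *)
Record subgraph := Subgraph {
  sub_vertices : {set G};
  sub_adj : rel G;
  sub_adj_sym : symmetric sub_adj;
  sub_adjP : forall u v, sub_adj u v ->
    [/\ u \in sub_vertices, v \in sub_vertices & adj u v] }.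

Definition boundary (R : subgraph) : {set G} :=
  [set v in sub_vertices R | [exists u, (u \notin sub_vertices R) && adj v u]].

(* A configuration is identified with the set of the vertices where it is 1,
   so that the pointwise order of bit strings is inclusion and the restriction
   of [s] to the boundary is [s :&: boundary R]. *)

Variable R : subgraph.

Definition independent (s : {set G}) : bool :=
  (s \subset sub_vertices R)
    && [forall u in s, forall v in s, ~~ sub_adj R u v].

Definition alpha (t : {set G}) : \bar int :=
  if independent t then
    ((\max_(s : {set G} | independent s && (s :&: boundary R == t)) #|s|)%N
       %:Z)%:E
  else -oo%E.

Definition irrelevant (t : {set G}) : bool :=
  (alpha t == -oo%E)
  || [exists s : {set G},
        [&& s \subset t, s != t & (alpha t <= alpha s)%E]].

Definition reduced_alpha (t : {set G}) : \bar int :=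
  if irrelevant t then -oo%E else alpha t.

Definition mis_group (t : {set G}) : {set {set G}} :=
  [set s : {set G} | [&& independent s, s :&: boundary R == t
                       & (#|s|%:Z)%:E == reduced_alpha t]].

Definition mis_groups : {set {set {set G}}} :=
  [set mis_group t | t : {set G} in powerset (boundary R)
                   & reduced_alpha t != -oo%E].

(* A clause is the set of its literals; [(v, true)] is the literal v and
   [(v, false)] is the literal not v. *)
Definition clause := {set G * bool}.

Definition clause_vertices (c : clause) : {set G} := [set l.1 | l in c].

Definition clause_positive (c : clause) : {set G} := [set v | (v, true) \in c].

Definition satisfies (s : {set G}) (c : clause) : bool :=
  [forall l in c, (l.1 \in s) == l.2].

Definition full_clause (s : {set G}) : clause :=
  [set l | (l.1 \in sub_vertices R) && (l.2 == (l.1 \in s))].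

(* The empty clause is excluded: it deletes nothing, so the equation that
   defines the branching complexity of the rule it forms holds for all gamma. *)
Definition branching_rule (D : seq clause) : Prop :=
  forall c, c \in D -> c != set0 /\ clause_vertices c \subset sub_vertices R.

Definition valid_rule (D : seq clause) : Prop :=
  forall S, S \in mis_groups ->
    exists2 s, s \in S & has (satisfies s) D.

(* [full_clause s] is empty only when the subgraph has no vertex. *)
Definition candidate_closed (X : {set clause}) : bool :=
  (set0 \notin X)
  && [forall s in cover mis_groups,
        ((full_clause s != set0) ==> (full_clause s \in X))
        && [forall c in X, (c :&: full_clause s != set0)
                             ==> (c :&: full_clause s \in X)]].

Definition candidates : {set clause} :=
  \bigcap_(X : {set clause} | candidate_closed X) X.

Definition candidate (i : 'I_#|candidates|) : clause := enum_val i.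

Definition covered (i : 'I_#|candidates|) : {set 'I_#|mis_groups|} :=
  [set j | [exists s in (enum_val j : {set {set G}}),
              satisfies s (candidate i)]].

End Graph.

Section Measure.
Variables (K : realType) (rho : sgraph -> K).

Definition monotone_measure : Prop :=
  forall (G : sgraph) (W W' : {set G}),
    W \subset W' -> rho (delete W') <= rho (delete W).

Variable G : sgraph.

Definition drho (c : clause G) : K :=
  rho G - rho (delete (clause_vertices c
                         :|: neighbourhood (clause_positive c))).

Definition branching_complexity (D : seq (clause G)) (gamma : K) : Prop :=
  1 <= gamma
  /\ gamma `^ rho G = \sum_(c <- D) gamma `^ (rho G - drho c).

Variable R : subgraph G.

Definition smallest_branching_complexity (gamma : K) : Prop :=
  (exists D, [/\ branching_rule R D, valid_rule R D
               & branching_complexity D gamma])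
  /\ (forall D gamma', branching_rule R D -> valid_rule R D ->
        branching_complexity D gamma' -> gamma <= gamma').

Definition weight (gamma : K) (i : 'I_#|candidates R|) : K :=
  gamma `^ (- drho (candidate i)).

(* [x] is the set of the indices i with x_i = 1. *)
Definition feasible (gamma : K) (x : {set 'I_#|candidates R|}) : Prop :=
  [/\ \sum_(i in x) weight gamma i = 1,
      \bigcup_(i in x) covered i = [set: 'I_#|mis_groups R|]
    & 1 <= gamma].

Definition optimal_value (gamma : K) : Prop :=
  (exists x, feasible gamma x)
  /\ (forall gamma' x, feasible gamma' x -> gamma <= gamma').

End Measure.

Definition wmsc_solution (K : realType) (U I : finType) (J : I -> {set U})
    (w : I -> K) (x : {set I}) : Prop :=
  \bigcup_(i in x) J i = [set: U]
  /\ (forall y : {set I}, \bigcup_(i in y) J i = [set: U] ->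
        \sum_(i in x) w i <= \sum_(i in y) w i).

Definition wmsc_oracle (K : realType) (U I : finType) (J : I -> {set U})
    (w : K -> I -> K) (oracle : K -> {set I}) : Prop :=
  forall gamma, 1 <= gamma -> wmsc_solution J (w gamma) (oracle gamma).

(* A real RAM with unit cost per instruction and per test. Its registers
   r_0, r_1, ... hold real numbers. Its only access to the set covering
   problems is the number of subsets, the weight of a subset at a given gamma,
   and the subcollection returned by the last oracle call. Programs are plain
   data with rational constants, so that one program has to serve all
   instances. *)

Inductive operation := Add | Sub | Mul | Div.

Inductive instruction :=
  | Const (d : nat) (q : rat)
  | Arith (o : operation) (d a b : nat)
  | NumSets (d : nat)
  | Weight (d g i : nat)
  | Query (g : nat)
  | Selected (d i : nat).

Inductive program :=
  | Skip
  | Do (ins : instruction)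
  | Seq (p1 p2 : program)
  | If (a b : nat) (p1 p2 : program) (* test r_a < r_b *)
  | While (a b : nat) (p : program). (* test r_a < r_b *)

Section Machine.
Variables (K : realType) (m : nat).
Variables (w : K -> 'I_m -> K) (oracle : K -> {set 'I_m}).

Record state := State { reg : nat -> K; answer : {set 'I_m} }.

Definition set_reg (s : state) (d : nat) (v : K) : state :=
  State (fun k => if k == d then v else reg s k) (answer s).

Definition apply_op (o : operation) (u v : K) : K :=
  match o with Add => u + v | Sub => u - v | Mul => u * v | Div => u / v end.

Definition index_of (v : K) : option 'I_m := [pick i : 'I_m | i%:R == v].

Definition exec_instruction (ins : instruction) (s : state) : state :=
  match ins with
  | Const d q => set_reg s d (ratr q)
  | Arith o d a b => set_reg s d (apply_op o (reg s a) (reg s b))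
  | NumSets d => set_reg s d m%:R
  | Weight d g i =>
      set_reg s d (if index_of (reg s i) is Some k then w (reg s g) k else 0)
  | Query g => State (reg s) (oracle (reg s g))
  | Selected d i =>
      set_reg s d
        (if index_of (reg s i) is Some k then (k \in answer s)%:R else 0)
  end.

(* [exec p s t s']: started in [s], the program [p] halts in [s'] after
   [t] steps. *)
Inductive exec : program -> state -> nat -> state -> Prop :=
  | ExecSkip s : exec Skip s 0 s
  | ExecDo ins s : exec (Do ins) s 1 (exec_instruction ins s)
  | ExecSeq p1 p2 s1 s2 s3 t1 t2 :
      exec p1 s1 t1 s2 -> exec p2 s2 t2 s3 ->
      exec (Seq p1 p2) s1 (t1 + t2) s3
  | ExecIf a b p1 p2 s s' t :
      exec (if reg s a < reg s b then p1 else p2) s t s' ->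
      exec (If a b p1 p2) s t.+1 s'
  | ExecWhileEnd a b p s :
      reg s b <= reg s a -> exec (While a b p) s 1 s
  | ExecWhileStep a b p s1 s2 s3 t1 t2 :
      reg s1 a < reg s1 b -> exec p s1 t1 s2 ->
      exec (While a b p) s2 t2 s3 ->
      exec (While a b p) s1 (t1 + t2).+1 s3.

Definition initial_state (v : K) : state :=
  State (fun k => if k == 0%N then v else 0) set0.

Definition outputs (p : program) (v : K) (t : nat) (out : K) : Prop :=
  exists2 s, exec p (initial_state v) t s & reg s 0 = out.

End Machine.

(* Main.v *)
Require Import Defs.
From mathcomp Require Import all_boot all_order all_algebra.
From mathcomp Require Import all_classical all_reals all_analysis.
From mathcomp Require Import fintype finset lra zify.
Set Implicit Arguments.
Unset Strict Implicit.
Unset Printing Implicit Defensive.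
Import Order.TTheory GRing.Theory Num.Theory.
Import numFieldNormedType.Exports.
Local Open Scope ring_scope.

(** Write F(gamma) for the least total weight of a covering at gamma, the
    number that one oracle call determines, and gamma_opt for the optimal
    value. The algorithm is a bisection on the sign of F - 1; what has to be
    seen is that F exceeds 1 exactly to the left of gamma_opt when
    1 < gamma_opt. This is not immediate, as the exponents may have either sign
    and the weight of a single covering need not be monotone in gamma.

    At gamma = 1 every weight is 1 and every covering weighs its cardinal, which
    is at least 1 because there is at least one group to cover (the empty
    boundary configuration is never irrelevant, [mis_groups_gt0]). If a
    covering weighs at most 1 at some gamma, the intermediate value theorem
    therefore makes it weigh exactly 1 at some point of [1, gamma], and
    gamma_opt <= gamma ([light_ge_opt]): F exceeds 1 below gamma_opt.
    Conversely, suppose 1 < gamma_opt and take a covering that weighs 1 at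
    gamma_opt. None of its terms exceeds 1 there, so none of its exponents is
    positive, its weight does not increase with gamma, and F is at most 1 above
    gamma_opt ([light_above_opt]). The case gamma_opt = 1 is recognized by one
    call of the oracle at 1. Otherwise doubling finds an upper bound in a
    number of calls that depends on the instance only, and
    log2 (2 gamma_opt / epsilon) halvings reach the precision epsilon
    ([runs_threshold_search], [affine_halvings_bigO]). The minimum gamma_opt is
    attained since the values of gamma at which some covering weighs exactly 1
    form a finite union of closed sets ([balanced_has_min]).

    Restricting to candidate clauses loses nothing. Replace a clause c of a
    valid rule by the conjunction c' of the literals common to all the
    maximum independent sets of the groups that satisfy c. It is a candidate,
    it is satisfied by the same sets, and, as c' contains c, it deletes
    at least the same vertices; a monotone measure drops at least as much, so
    the weight does not grow ([rule_dominated]). *)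

(** * The bisection program *)

(** Registers: r0 holds epsilon and, at the end, the result; r1, r2, r12 the
    constants 1, 0, 2, so that adding r2 copies a register; r3 the number of
    subsets; r4 the point of the last query and r6 the weight of its answer;
    r5, r7, r8 are scratch of the summation; r9 and r10 bound the threshold
    from below and above, and r11 is their distance. The sum runs over all
    subsets, and multiplying by the bit of the answer leaves only the selected
    ones. *)
Definition evaluate : program :=
  Seq (Do (Query 4))
 (Seq (Do (Const 5 0))
 (Seq (Do (Const 6 0))
      (While 5 3
        (Seq (Do (Weight 7 4 5))
        (Seq (Do (Selected 8 5))
        (Seq (Do (Arith Mul 7 7 8))
        (Seq (Do (Arith Add 6 6 7))
             (Do (Arith Add 5 5 1))))))))).

Definition double_upper_bound : program :=
  While 1 6 (Seq (Do (Arith Add 4 4 4)) evaluate).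

Definition bisect : program :=
  While 0 11
    (Seq (Do (Arith Add 4 9 10))
    (Seq (Do (Arith Div 4 4 12))
    (Seq evaluate
    (Seq (If 1 6 (Do (Arith Add 9 4 2)) (Do (Arith Add 10 4 2)))
         (Do (Arith Defs.Sub 11 10 9)))))).

Definition threshold_search : program :=
  Seq (Do (Const 1 1))
 (Seq (Do (Const 2 0))
 (Seq (Do (NumSets 3))
 (Seq (Do (Const 4 1))
 (Seq evaluate
      (If 1 6
         (Seq double_upper_bound
         (Seq (Do (Const 9 1))
         (Seq (Do (Arith Add 10 4 2))
         (Seq (Do (Const 12 2))
         (Seq (Do (Arith Defs.Sub 11 10 9))
         (Seq bisect
              (Do (Arith Add 0 9 2))))))))
         (Do (Const 0 1))))))).

(** * Executing the program *)

Section Machine.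
Variables (K : realType) (m : nat).
Variables (w : K -> 'I_m -> K) (oracle : K -> {set 'I_m}).
Implicit Types (p : program) (s : state K m) (Q : state K m -> Prop).

(** Total correctness with a time bound, so that time bounds add up along the
    syntax of the program. *)
Definition runs p s n Q : Prop :=
  exists t s', [/\ exec w oracle p s t s', (t <= n)%N & Q s'].

Lemma runs_seq p1 p2 s n1 n2 Q :
  runs p1 s n1 (fun s' => runs p2 s' n2 Q) -> runs (Seq p1 p2) s (n1 + n2) Q.
Proof.
case=> t1 [s1 [e1 le1 [t2 [s2 [e2 le2 Qs2]]]]].
exists (t1 + t2)%N, s2; split=> //; first exact: ExecSeq e1 e2.
exact: leq_add.
Qed.

Lemma runs_do ins s Q :
  Q (exec_instruction w oracle ins s) -> runs (Do ins) s 1 Q.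
Proof.
move=> Qs; exists 1%N, (exec_instruction w oracle ins s); split=> //.
exact: ExecDo.
Qed.

Lemma runs_do_seq ins p s n Q :
  runs p (exec_instruction w oracle ins s) n Q ->
  runs (Seq (Do ins) p) s n.+1 Q.
Proof. by move=> h; rewrite -add1n; apply: runs_seq; apply: runs_do. Qed.

Lemma runs_if a b p1 p2 s n Q :
  runs (if reg s a < reg s b then p1 else p2) s n Q ->
  runs (If a b p1 p2) s n.+1 Q.
Proof.
by case=> t [s' [e le Qs]]; exists t.+1, s'; split=> //; exact: ExecIf.
Qed.

Lemma runs_weaken p s n n' Q Q' :
  runs p s n Q -> (n <= n')%N -> (forall s', Q s' -> Q' s') -> runs p s n' Q'.
Proof.
case=> t [s' [e le Qs]] le' QQ'.
by exists t, s'; split; [|exact: leq_trans le'|exact: QQ'].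
Qed.

(** The index of the invariant bounds the number of remaining iterations;
    the guard must be false when it is 0. *)
Lemma runs_while a b p (I : nat -> state K m -> Prop) c Q :
  (forall k s, I k s -> reg s a < reg s b ->
     exists2 k', k = k'.+1 & runs p s c (I k')) ->
  (forall k s, I k s -> reg s b <= reg s a -> Q s) ->
  forall k s, I k s -> runs (While a b p) s (k * c.+1).+1 Q.
Proof.
move=> step stop; elim=> [|k IHk] s Is.
  have [/(step _ _ Is)[]//|ge] := ltP (reg s a) (reg s b).
  by exists 1%N, s; split; [exact: ExecWhileEnd| |exact: stop _ _ Is ge].
have [lt|ge] := ltP (reg s a) (reg s b); last first.
  by exists 1%N, s; split; [exact: ExecWhileEnd| |exact: stop _ _ Is ge].
have [_ [<-] [t1 [s1 [e1 le1 /IHk[t2 [s2 [e2 le2 Qs2]]]]]]] := step _ _ Is lt.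
exists (t1 + t2).+1, s2; split=> //; first exact: ExecWhileStep e1 e2.
by rewrite mulSn; lia.
Qed.

Lemma index_ofE (i : 'I_m) : @index_of K m i%:R = Some i.
Proof.
rewrite /index_of; case: pickP => [j|/(_ i)/=].
  by rewrite eqr_nat => /eqP e; congr Some; apply/val_inj.
by rewrite eqxx.
Qed.

Definition query_weight (gamma : K) : K := \sum_(i in oracle gamma) w gamma i.

Definition evaluation_cost : nat := m * 6 + 4.

Lemma runs_evaluate s : reg s 1 = 1 -> reg s 3 = m%:R ->
  runs evaluate s evaluation_cost (fun s' => reg s' 6 = query_weight (reg s 4) /\
    forall k, k \notin [:: 5; 6; 7; 8]%N -> reg s' k = reg s k).
Proof.
move=> r1 r3; rewrite /evaluation_cost addnS addnS addnS.
do 3 apply: runs_do_seq; rewrite addn1.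
pose A := oracle (reg s 4).
(* k subsets remain to be read. *)
pose I k (s' : state K m) :=
  [/\ (k <= m)%N, reg s' 5 = (m - k)%:R,
      reg s' 6 = \sum_(i : 'I_m | (i < m - k)%N) w (reg s 4) i * (i \in A)%:R,
      answer s' = A
    & forall j, j \notin [:: 5; 6; 7; 8]%N -> reg s' j = reg s j].
apply: (runs_while (I := I)).
- move=> [|k] s' [km r5 r6 ans fr]; rewrite r5 (fr 3%N) // r3 ltr_nat.
    by rewrite subn0 ltnn.
  move=> lt; exists k => //.
  have lti : (m - k.+1 < m)%N by lia.
  pose i : 'I_m := Ordinal lti.
  have ix : @index_of K m (m - k.+1)%:R = Some i by rewrite -(index_ofE i).
  do 4 apply: runs_do_seq; apply: runs_do; split=> /=.
  + exact: ltnW.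
  + by rewrite r5 (fr 1%N) // r1 natr1; congr (_%:R); lia.
  + rewrite r5 r6 ans (fr 4%N) //.
    rewrite ix [RHS](bigD1 i) /=; last by lia.
    rewrite addrC; congr (_ + _); apply: eq_bigl => j.
    by rewrite -val_eqE /= /i /=; lia.
  + exact: ans.
  + move=> j jn; rewrite -(fr j jn); move: jn.
    rewrite !inE !negb_or => /and4P[n5 n6 n7 n8].
    by rewrite (negPf n5) (negPf n6) (negPf n7) (negPf n8).
- move=> k s' [km r5 r6 ans fr]; rewrite r5 (fr 3%N) // r3 ler_nat => ge.
  split=> //; rewrite r6 /query_weight [RHS]big_mkcond [LHS]big_mkcond /=.
  apply: eq_bigr => i _; have -> : (i < m - k)%N by have := ltn_ord i; lia.
  by rewrite -/A; case: (i \in A); rewrite ?mulr1 ?mulr0.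
- split=> //=; rewrite ?subnn ?rmorph0 // ?raddf0 //.
  + by rewrite big1.
  + move=> j; rewrite !inE !negb_or => /and4P[n5 n6 n7 n8].
    by rewrite (negPf n5) (negPf n6).
Qed.

Section Threshold.
Variable threshold : K.
Hypothesis threshold_ge1 : 1 <= threshold.
Hypothesis query_weight_gt1 :
  forall gamma, 1 <= gamma -> (1 < query_weight gamma) = (gamma < threshold).

(** The last doubling starts from a point below the threshold, whence the
    factor 2. *)
Lemma runs_double_upper_bound s N :
  reg s 1 = 1 -> reg s 3 = m%:R -> reg s 4 = 1 -> reg s 6 = query_weight 1 ->
  threshold <= 2 ^+ N ->
  runs double_upper_bound s (N * evaluation_cost.+2).+1 (fun s' =>
    threshold <= reg s' 4 <= 2 * threshold /\
    forall k, k \notin [:: 4; 5; 6; 7; 8]%N -> reg s' k = reg s k).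
Proof.
move=> r1 r3 r4 r6 leN.
(* k more doublings certainly reach the threshold. *)
pose I k (s' : state K m) :=
  [/\ 1 <= reg s' 4 <= 2 * threshold, threshold <= reg s' 4 * 2 ^+ k,
      reg s' 6 = query_weight (reg s' 4)
    & forall j, j \notin [:: 4; 5; 6; 7; 8]%N -> reg s' j = reg s j].
apply: (runs_while (I := I)).
- move=> k s' [/andP[ge1 le2] lek r6' fr].
  rewrite r6' (fr 1%N) // r1 (query_weight_gt1 ge1) => lt.
  case: k lek => [|k lek]; first by rewrite expr0 mulr1 leNgt lt.
  exists k => //; apply: runs_do_seq.
  apply: runs_weaken (runs_evaluate _ _) _ _ => //=.
  + by rewrite fr.
  + by rewrite fr.
  + move=> s2 [c2 fr2].
    have f4 : reg s2 4 = reg s' 4 + reg s' 4 by rewrite fr2.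
    split.
    * by rewrite f4; lra.
    * by rewrite f4; move: lek; rewrite exprS; lra.
    * by rewrite f4.
    * move=> j jn; rewrite fr2; last by move: jn; rewrite !inE; case: (j == 4%N).
      by rewrite /= ifN ?fr //; move: jn; rewrite !inE; case: (j == 4%N).
- move=> k s' [/andP[ge1 le2] lek r6' fr].
  rewrite r6' (fr 1%N) // r1 leNgt (query_weight_gt1 ge1) -leNgt => ge.
  by rewrite ge le2.
- split=> //.
  + by rewrite r4 lexx /=; move: threshold_ge1; lra.
  + by rewrite r4 mul1r.
  + by rewrite r6 r4.
Qed.

Lemma runs_bisect s n :
  reg s 1 = 1 -> reg s 2 = 0 -> reg s 3 = m%:R -> reg s 12 = 2 ->
  1 <= reg s 9 <= threshold -> threshold <= reg s 10 ->
  reg s 11 = reg s 10 - reg s 9 -> reg s 11 <= reg s 0 * 2 ^+ n ->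
  runs bisect s (n * (evaluation_cost + 6)).+1 (fun s' =>
    `|reg s' 9 - threshold| <= reg s 0 /\ reg s' 2 = 0).
Proof.
move=> r1 r2 r3 r12 lo hi diff width.
(* k more halvings certainly bring the width down to epsilon. *)
pose I k (s' : state K m) :=
  [/\ 1 <= reg s' 9 <= threshold, threshold <= reg s' 10,
      reg s' 11 = reg s' 10 - reg s' 9, reg s' 11 <= reg s 0 * 2 ^+ k
    & forall j, j \in [:: 0; 1; 2; 3; 12]%N -> reg s' j = reg s j].
rewrite (_ : (_ + 6 = (evaluation_cost + 5).+1)%N); last by rewrite addnS.
apply: (runs_while (I := I)) => [| |//];
  move=> k s' [/andP[ge1 lo'] hi' diff' width' fr].
- rewrite (fr 0%N) // => lt.
  case: k width' => [|k width']; first by rewrite expr0 mulr1 leNgt lt.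
  exists k => //.
  rewrite (_ : (_ + 5 = (evaluation_cost + 3).+2)%N); last by rewrite /=; lia.
  do 2 apply: runs_do_seq; apply: runs_seq.
  apply: runs_weaken (runs_evaluate _ _) (leqnn _) _ => [||s2 [c2 fr2]] /=.
  + by rewrite fr.
  + by rewrite fr.
  have f4 : reg s2 4 = (reg s' 9 + reg s' 10) / 2.
    by rewrite fr2 //= (fr 12%N) // r12.
  have {}c2 : reg s2 6 = query_weight (reg s2 4).
    by rewrite c2 f4 /= (fr 12%N) // r12.
  have f9 : reg s2 9 = reg s' 9 by rewrite fr2.
  have f10 : reg s2 10 = reg s' 10 by rewrite fr2.
  have g j : j \in [:: 0; 1; 2; 3; 12]%N -> reg s2 j = reg s j.
    by move=> jI; rewrite -fr // fr2 ?inE;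
      move: jI; rewrite !inE => /or4P[| | |/orP[]] /eqP ->.
  have mid1 : 1 <= reg s2 4 by rewrite f4; lra.
  have split_if :
      (if reg s2 1 < reg s2 6 then Do (Arith Add 9 4 2)
       else Do (Arith Add 10 4 2)) =
      Do (Arith Add (if reg s2 4 < threshold then 9 else 10) 4 2).
    by rewrite c2 (g 1%N) // r1 (query_weight_gt1 mid1); case: ifP.
  apply: (@runs_seq _ _ _ 2 1); apply: runs_if; rewrite split_if.
  apply/runs_do/runs_do.
  move: width'; rewrite exprS => width'.
  case: ltP => cmp; split=> /=; rewrite ?f4 ?f9 ?f10 ?(g 2%N) // ?r2;
    move: cmp; rewrite f4 => cmp; try lra.
  + move=> j jI; rewrite -(g j) //; move: jI.
    by rewrite !inE => /or4P[| | |/orP[]] /eqP ->.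
  + move=> j jI; rewrite -(g j) //; move: jI.
    by rewrite !inE => /or4P[| | |/orP[]] /eqP ->.
- rewrite (fr 0%N) // => ge; split; last by rewrite fr.
  by rewrite ler_norml; lra.
Qed.

End Threshold.

(** [N] bounds the number of doublings and [n] that of halvings. *)
Definition search_cost (N n : nat) : nat :=
  evaluation_cost + 12 + N * evaluation_cost.+2 + n * (evaluation_cost + 6).

(** When the threshold is 1, the weight is only known at 1 itself; the first
    query must therefore settle that case. *)
Lemma runs_threshold_search threshold epsilon N n :
  0 < epsilon -> 1 <= threshold -> (1 < query_weight 1) = (1 < threshold) ->
  (1 < threshold ->
    forall gamma, 1 <= gamma -> (1 < query_weight gamma) = (gamma < threshold)) ->
  threshold <= 2 ^+ N -> 2 * threshold <= epsilon * 2 ^+ n ->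
  runs threshold_search (initial_state m epsilon) (search_cost N n)
    (fun s => `|reg s 0 - threshold| <= epsilon).
Proof.
move=> e0 threshold_ge1 query_weight1 query_weight_gt1 leN len.
rewrite /search_cost (_ : (_ + 12 + _ + _ =
  (evaluation_cost + (8 + N * evaluation_cost.+2 + n * (evaluation_cost + 6))).+4)%N);
  last by rewrite /=; lia.
do 4 apply: runs_do_seq; apply: runs_seq.
apply: runs_weaken (runs_evaluate _ _) (leqnn _) _ => [||s2 [c2 fr2]] /=.
+ by rewrite rmorph1.
+ by [].
rewrite /= rmorph1 in c2.
have r1 : reg s2 1 = 1 by rewrite fr2 //= rmorph1.
have r2 : reg s2 2 = 0 by rewrite fr2 //= rmorph0.
have r3 : reg s2 3 = m%:R by rewrite fr2.
have r4 : reg s2 4 = 1 by rewrite fr2 //= rmorph1.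
have r0 : reg s2 0 = epsilon by rewrite fr2.
rewrite -addnA addSn; apply: runs_if; rewrite c2 r1 query_weight1.
case: ltP => [gt1|le1]; last first.
  apply: runs_weaken (runs_do _) _ _ => //; last by move=> s; exact.
  have -> : threshold = 1 by apply/le_anti/andP.
  by rewrite /= rmorph1 subrr normr0 ltW.
rewrite (_ : (7 + (_ + _) =
  (N * evaluation_cost.+2).+1 + (4 + (n * (evaluation_cost + 6)).+2))%N);
  last by rewrite /=; lia.
apply: runs_seq.
have doubled :=
  runs_double_upper_bound threshold_ge1 (query_weight_gt1 gt1) r1 r3 r4 c2 leN.
apply: runs_weaken doubled (leqnn _) _ => s3 [/andP[lo hi] fr3].
rewrite (_ : (4 + _ = ((n * (evaluation_cost + 6)).+1 + 1).+4)%N);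
  last by rewrite /=; lia.
do 4 apply: runs_do_seq; apply: runs_seq.
have bisected := runs_bisect threshold_ge1 (query_weight_gt1 gt1) (n := n).
apply: runs_weaken (bisected _ _ _ _ _ _ _ _ _) (leqnn _) _ => /=.
all: rewrite ?(fr3 0%N) ?(fr3 1%N) ?(fr3 2%N) ?(fr3 3%N) //.
all: rewrite ?rmorph1 ?r2 ?addr0 ?r0 //.
- by rewrite rmorph_nat.
- by rewrite lexx.
- by move: lo hi len; lra.
move=> s4 [close s42].
apply: runs_weaken (runs_do _) _ _ => //; last by move=> s; exact.
by rewrite /= s42 addr0.
Qed.

End Machine.

(** * Total weight of a covering as a function of gamma *)

Lemma closed_has_min (K : realType) (A : set K) (a : K) :
  closed A -> (A !=set0)%classic -> lbound A a ->
  exists2 l, A l & lbound A l.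
Proof.
move=> clA A0 lbA; exists (inf A); last first.
  by apply: ge_inf; exists a.
apply: (itv_closed_infimums A0 clA); split.
  by apply: ge_inf; exists a.
by move=> b lbb; exact: lb_le_inf.
Qed.

Section Cover.
Variables (K : realType) (U I : finType) (J : I -> {set U}) (d : I -> K).
Hypothesis U_gt0 : (0 < #|U|)%N.
Implicit Types (x y : {set I}) (gamma : K).

Definition covers x : Prop := \bigcup_(i in x) J i = [set: U].

Definition power_weight gamma i : K := gamma `^ (- d i).

Definition weight_sum x gamma : K := \sum_(i in x) power_weight gamma i.

(** In the variable u = ln gamma the weights are exponentials, which are
    continuous everywhere. *)
Lemma weight_sum_expR x u :
  weight_sum x (expR u) = \sum_(i in x) expR (u * - d i).
Proof. by apply: eq_bigr => i _; rewrite /power_weight expRM. Qed.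

Lemma continuous_weight_sum_expR x :
  continuous (fun u => weight_sum x (expR u)).
Proof.
rewrite (_ : (fun u => _) = (fun u => \sum_(i in x) expR (u * - d i))).
  apply: continuous_big => [|i _ u].
    exact: add_continuous.
  apply: continuous_comp; last exact: continuous_expR.
  exact: mulrr_continuous.
by apply/funext => u; rewrite weight_sum_expR.
Qed.

Lemma covering_gt0 x : covers x -> (0 < #|x|)%N.
Proof.
move=> cx; rewrite card_gt0; apply: contraTneq U_gt0 => x0.
by move: cx; rewrite /covers x0 big_set0 -cardsT => <-; rewrite cards0.
Qed.

Lemma weight_sum1 x : weight_sum x 1 = #|x|%:R.
Proof.
rewrite /weight_sum (eq_bigr (fun=> 1)) ?sumr_const // => i _.
by rewrite /power_weight powR1.
Qed.

Lemma weight_sum1_ge1 x : covers x -> 1 <= weight_sum x 1.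
Proof. by move/covering_gt0; rewrite weight_sum1 ler1n. Qed.

Definition balanced gamma x : Prop :=
  [/\ weight_sum x gamma = 1, covers x & 1 <= gamma].

(** The weight is at least 1 at gamma = 1, so it passes through 1 on the way. *)
Lemma balanced_below x gamma :
  covers x -> 1 <= gamma -> weight_sum x gamma <= 1 ->
  exists2 gamma', balanced gamma' x & gamma' <= gamma.
Proof.
move=> cx g1 le1.
have g0 : 0 < gamma by exact: lt_le_trans g1.
have u0 : 0 <= ln gamma by exact: ln_ge0.
have [||c] := @IVT K (fun u => weight_sum x (expR u)) 0 (ln gamma) 1 u0.
- apply: continuous_subspaceT; exact: continuous_weight_sum_expR.
- by rewrite expR0 lnK ?posrE // ge_min le1 orbT le_max weight_sum1_ge1.
rewrite in_itv /= => /andP[c0 cu] e; exists (expR c).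
  by split=> //; rewrite -expR0 ler_expR.
by rewrite -[gamma]lnK ?posrE // ler_expR.
Qed.

(** Each covering is in balance on a closed set, and there are finitely many
    coverings. *)
Lemma balanced_has_min : (exists gamma x, balanced gamma x) ->
  exists2 gamma, (exists x, balanced gamma x)
               & forall gamma' x, balanced gamma' x -> gamma <= gamma'.
Proof.
move=> [g [x bx]].
pose A : set K := (\bigcup_(y in [set y | covers y])
  ([set u | weight_sum y (expR u) = 1] `&` [set u | 0 <= u]))%classic.
have AP gamma y : balanced gamma y -> A (ln gamma).
  case=> e cy g1; exists y => //; split=> /=; last exact: ln_ge0.
  by rewrite lnK // posrE (lt_le_trans _ g1).
have [||| u [y /= cy [e u0]] umin] := @closed_has_min K A 0.
- apply: closed_bigcup => [|y _]; first exact: finite_finset.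
  apply: closedI; last exact: closed_ge.
  apply: (@preimage_closed _ _ (fun u => weight_sum y (expR u))
            [set r | r = 1]%classic) => [u _|].
    exact: continuous_weight_sum_expR.
  exact: closed_eq.
- by exists (ln g); exact: AP bx.
- by move=> u [y _ []].
exists (expR u); first by exists y; split=> //; rewrite -expR0 ler_expR.
move=> g' y' b; rewrite -[g']lnK ?ler_expR; first exact/umin/AP/b.
by case: b => _ _ g1; rewrite posrE (lt_le_trans _ g1).
Qed.

Section Minimum.
Variable gamma_opt : K.
Hypothesis opt_attained : exists x, balanced gamma_opt x.
Hypothesis opt_min : forall gamma x, balanced gamma x -> gamma_opt <= gamma.

Lemma opt_ge1 : 1 <= gamma_opt.
Proof. by case: opt_attained => x []. Qed.

Lemma light_ge_opt x gamma :
  covers x -> 1 <= gamma -> weight_sum x gamma <= 1 -> gamma_opt <= gamma.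
Proof. by move=> cx g1 /(balanced_below cx g1)[g' /opt_min]; exact: le_trans. Qed.

(** An exponent of the wrong sign would give a term larger than 1 in a sum
    equal to 1, so the optimal covering only gets lighter. With gamma_opt = 1
    the bound can fail: a single subset with d i < 0 is in balance at 1 and
    too heavy afterwards. *)
Lemma light_above_opt gamma : 1 < gamma_opt -> gamma_opt <= gamma ->
  exists2 x, covers x & weight_sum x gamma <= 1.
Proof.
move=> o1 le; case: opt_attained => x [e cx _]; exists x => //.
rewrite -e; apply: ler_sum => i ix; rewrite /power_weight !powRN.
have d0 : 0 <= d i.
  rewrite leNgt; apply/negP => di.
  have : weight_sum x gamma_opt <= 1 by rewrite e.
  rewrite leNgt => /negP; apply; rewrite /weight_sum (bigD1 i) //=.
  apply: ltr_wpDr; first by apply: sumr_ge0 => j _; exact: powR_ge0.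
  rewrite /power_weight (_ : 1 = 1 `^ - d i); last by rewrite powR1.
  by apply: gt0_ltr_powR; rewrite ?oppr_gt0 ?nnegrE // ltW // (lt_trans _ o1).
have o0 : 0 < gamma_opt by exact: lt_trans o1.
rewrite lef_pV2 ?posrE ?powR_gt0 //; last exact: lt_le_trans le.
by rewrite ge0_ler_powR // nnegrE ltW //; exact: lt_le_trans le.
Qed.

Variable oracle : K -> {set I}.
Hypothesis oracleP : wmsc_oracle J power_weight oracle.

(** The oracle returns a covering, so its weight obeys [light_ge_opt]; the
    covering is lightest, so its weight is at most that of the one given by
    [light_above_opt]. *)
Lemma oracle_gt1 gamma : 1 < gamma_opt -> 1 <= gamma ->
  (1 < weight_sum (oracle gamma) gamma) = (gamma < gamma_opt).
Proof.
move=> o1 g1; have [cx xmin] := oracleP g1; apply/idP/idP.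
  rewrite !ltNge; apply: contra => /(light_above_opt o1)[y cy].
  by apply: le_trans; exact: xmin.
rewrite !ltNge; apply: contra; exact: light_ge_opt.
Qed.

(** At gamma = 1 the equivalence holds also when gamma_opt = 1, since a
    covering is then in balance at 1. *)
Lemma oracle1 : (1 < weight_sum (oracle 1) 1) = (1 < gamma_opt).
Proof.
have [cx xmin] := oracleP (lexx 1); apply/idP/idP.
  rewrite !ltNge; apply: contra => le1.
  have opt1 : gamma_opt = 1 by apply/le_anti; rewrite le1 opt_ge1.
  case: opt_attained => y [e cy _]; rewrite -[leRHS]e opt1; exact: xmin.
rewrite !ltNge; apply: contra; exact: light_ge_opt.
Qed.

End Minimum.
End Cover.

(** * Number of halvings *)

Section Time.
Local Open Scope classical_set_scope.
Variable K : realType.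

Definition halvings (a epsilon : K) : nat :=
  (Num.truncn (ln (a / epsilon) / ln 2)).+1.

Lemma ln2_gt0 : 0 < ln 2 :> K. Proof. by rewrite ln_gt0 // ltr1n. Qed.

Lemma halvingsP a epsilon : 0 < a -> 0 < epsilon ->
  a <= epsilon * 2 ^+ halvings a epsilon.
Proof.
move=> a0 e0; rewrite mulrC -ler_pdivrMr //.
rewrite -[a / _]lnK ?posrE ?divr_gt0 // -[X in X ^+ _]lnK ?posrE //.
rewrite -expRM_natl ler_expR.
by rewrite -ler_pdivrMr ?ln2_gt0 // ltW // truncnS_gt.
Qed.

(** As soon as epsilon <= 1 / e, the logarithm of 1 / epsilon is at least 1 and
    absorbs the additive constants. *)
Lemma affine_halvings_bigO (a : K) (b c : nat) : 1 <= a ->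
  ((fun epsilon => (b + halvings a epsilon * c)%:R : K) : K -> K) =O_ (0^'+)
     (fun epsilon : K => ln epsilon^-1).
Proof.
move=> a1; have a0 : 0 < a by exact: lt_le_trans a1.
apply/eqO_exP; pose C := b%:R + (ln a / ln 2 + (ln 2)^-1 + 1) * c%:R.
have l2_gt0 := ln2_gt0.
have C_ge0 : 0 <= C.
  have l2_ge0 := ltW l2_gt0.
  by rewrite addr_ge0 // mulr_ge0 // !addr_ge0 //
              ?divr_ge0 ?invr_ge0 ?ln_ge0 ?ler1n.
exists (C + 1); first by rewrite ltr_wpDl.
near=> e.
have e0 : 0 < e by near: e; exact: nbhs_right_gt.
have L1 : 1 <= ln e^-1.
  rewrite -[1]expRK ler_ln ?posrE ?expR_gt0 ?invr_gt0 // -[expR 1]invrK.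
  rewrite lef_pV2 ?posrE ?invr_gt0 ?expR_gt0 //.
  by near: e; apply: nbhs_right_ltW; rewrite invr_gt0 expR_gt0.
rewrite !normr_nat ger0_norm; last by lra.
rewrite natrD natrM /halvings.
have h : ((Num.truncn (ln (a / e) / ln 2)).+1%:R : K) <=
    (ln a / ln 2 + (ln 2)^-1 + 1) * ln e^-1.
  have z0 : 0 <= ln (a / e) / ln 2.
    apply: divr_ge0; last exact: ltW.
    by rewrite lnM ?posrE ?invr_gt0 // addr_ge0 // ?(le_trans _ L1) // ln_ge0.
  rewrite -natr1; apply: (@le_trans _ _ (ln (a / e) / ln 2 + 1)).
    by rewrite lerD2r truncn_le.
  rewrite lnM ?posrE ?invr_gt0 // !mulrDl mul1r lerD // lerD //.
    by rewrite ler_peMr // divr_ge0 ?ln_ge0 ?ler1n.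
  by rewrite mulrC.
apply: (@le_trans _ _ (C * ln e^-1)); last first.
  by rewrite ler_wpM2r //; lra.
rewrite /C mulrDl lerD //; first by rewrite ler_peMr.
by rewrite [leRHS]mulrAC ler_wpM2r.
Unshelve. all: by end_near.
Qed.

End Time.

(** * Candidate clauses and branching rules *)

Section Subgraph.
Variables (G : sgraph) (R : subgraph G).
Implicit Types (s : {set G}) (c : clause G).

(** No configuration lies strictly below the empty one, which is independent,
    so its group is present. *)
Lemma mis_groups_gt0 : (0 < #|mis_groups R|)%N.
Proof.
have alpha0 : alpha R set0 != -oo%E.
  rewrite /alpha ifT //; apply/andP; split; first exact: sub0set.
  by apply/forall_inP => u; rewrite inE.
have red0 : reduced_alpha R set0 != -oo%E.
  rewrite /reduced_alpha /irrelevant (negPf alpha0) /= ifF //.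
  by apply/negbTE/existsPn => s; rewrite subset0; case: eqP.
apply/card_gt0P; exists (mis_group R set0).
by apply/imset_f; rewrite inE red0 powersetE sub0set.
Qed.

Lemma satisfies_subset s c : satisfies s c ->
  clause_vertices c \subset sub_vertices R -> c \subset full_clause R s.
Proof.
move=> /forall_inP sc /subsetP cR; apply/subsetP => l lc.
by rewrite inE cR ?imset_f //= eq_sym sc.
Qed.

Lemma full_clause_satisfied s c : c \subset full_clause R s -> satisfies s c.
Proof.
move=> /subsetP cf; apply/forall_inP => l /cf.
by rewrite inE eq_sym => /andP[].
Qed.

Lemma candidates_closed : candidate_closed R (candidates R).
Proof.
have closedP (X : {set clause G}) :
    candidate_closed R X -> candidates R \subset X.
  exact: bigcap_inf.
have full_closed : candidate_closed R [set c | c != set0].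
  rewrite /candidate_closed inE eqxx /=; apply/forall_inP => s _.
  by rewrite inE implybb /=; apply/forall_inP => c _; rewrite inE implybb.
apply/andP; split.
  by apply/negP => /(subsetP (closedP _ full_closed)); rewrite inE eqxx.
apply/forall_inP => s sM; apply/andP; split.
  apply/implyP => f0; apply/bigcapP => X /andP[_ /forall_inP/(_ s sM)/andP[h _]].
  exact: implyP f0.
apply/forall_inP => c cC; apply/implyP => cf0; apply/bigcapP => X clX.
have cX := subsetP (closedP _ clX) _ cC.
case/andP: clX => _ /forall_inP/(_ s sM)/andP[_ /forall_inP/(_ c cX)/implyP].
exact.
Qed.

Definition common_clause c : clause G :=
  \bigcap_(s in cover (mis_groups R) | satisfies s c) full_clause R s.

Lemma common_clause_sub c : clause_vertices c \subset sub_vertices R ->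
  c \subset common_clause c.
Proof.
move=> cR; apply/bigcapsP => s /andP[_ sc]; exact: satisfies_subset.
Qed.

Lemma common_clause_satisfied s c : s \in cover (mis_groups R) ->
  satisfies s c -> satisfies s (common_clause c).
Proof.
move=> sM sc; apply/full_clause_satisfied/bigcap_inf; exact/andP.
Qed.

(** Closure under a single intersection is iterated over the configurations
    that satisfy [c]. Every partial intersection still contains the literals of
    [c], hence is not empty and stays a candidate; starting from the full
    clause of [s] avoids the empty intersection. *)
Lemma common_clause_candidate s c : c != set0 ->
  clause_vertices c \subset sub_vertices R ->
  s \in cover (mis_groups R) -> satisfies s c ->
  common_clause c \in candidates R.
Proof.
move=> c0 cR sM sc.
have /andP[_ /forall_inP closed] := candidates_closed.
have ne (X : clause G) : c \subset X -> X != set0.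
  by move=> cX; apply: contraNneq c0 => X0; rewrite -subset0 -X0.
pose partial (r : seq {set G}) : clause G :=
  \bigcap_(t <- r | (t \in cover (mis_groups R)) && satisfies t c)
    full_clause R t.
suff H r : c \subset partial r /\ partial r :&: full_clause R s \in candidates R.
  have [_] := H (index_enum _).
  rewrite (_ : _ :&: _ = common_clause c) //.
  apply/setIidPl; apply: bigcap_inf; exact/andP.
have cs := satisfies_subset sc cR.
elim: r => [|t r [cX IH]] /=.
  rewrite /partial big_nil subsetT setTI; split=> //.
  by have /andP[/implyP -> //] := closed _ sM; exact: ne.
rewrite /partial big_cons -/(partial r); case: ifP => // /andP[tM tc].
have ct := satisfies_subset tc cR.
split; first by rewrite subsetI ct.
rewrite -setIA setIC.
have /andP[_ /forall_inP/(_ _ IH)/implyP] := closed _ tM; apply.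
by apply: ne; rewrite !subsetI cX cs ct.
Qed.

(** A neighbour of a positive literal of [c] may become a positive literal of
    [c'], but then it is deleted as a vertex of [c']. *)
Lemma deleted_mono c c' : c \subset c' ->
  clause_vertices c :|: neighbourhood (clause_positive c)
    \subset clause_vertices c' :|: neighbourhood (clause_positive c').
Proof.
move=> /subsetP cc'; apply/subsetP => v; rewrite !inE => /orP[/imsetP[l lc ->]|].
  by rewrite imset_f // cc'.
case/andP=> vp /exists_inP[u up uv].
have [vp'|vp'] /= := boolP ((v, true) \in c').
  by rewrite (_ : v \in clause_vertices c') //; apply/imsetP; exists (v, true).
apply/orP; right; apply/exists_inP; exists u => //.
by move: up; rewrite !inE => /cc'.
Qed.

End Subgraph.

Section Rules.
Variables (K : realType) (rho : sgraph -> K) (G : sgraph) (R : subgraph G).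

Lemma drho_mono (c c' : clause G) : monotone_measure rho -> c \subset c' ->
  drho rho c <= drho rho c'.
Proof. by move=> mono cc'; rewrite lerD2l lerN2 mono // deleted_mono. Qed.

Lemma branching_complexityE (D : seq (clause G)) (gamma : K) : 0 < gamma ->
  (gamma `^ rho G = \sum_(c <- D) gamma `^ (rho G - drho rho c)) <->
  \sum_(c <- D) gamma `^ (- drho rho c) = 1.
Proof.
move=> g0.
have -> : \sum_(c <- D) gamma `^ (rho G - drho rho c) =
          gamma `^ rho G * \sum_(c <- D) gamma `^ (- drho rho c).
  rewrite mulr_sumr; apply: eq_bigr => c _; rewrite powRD //.
  by apply/implyP => _; rewrite gt_eqF.
have ne : gamma `^ rho G != 0 by rewrite gt_eqF // powR_gt0.
split=> [e|->]; last by rewrite mulr1.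
by apply: (mulfI ne); rewrite -e mulr1.
Qed.

Lemma covered_valid (x : {set 'I_#|candidates R|}) :
  \bigcup_(i in x) covered i = [set: 'I_#|mis_groups R|] ->
  valid_rule R [seq candidate i | i <- enum x].
Proof.
move=> cx S SM.
have : enum_rank_in SM S \in \bigcup_(i in x) covered i by rewrite cx inE.
case/bigcupP => i ix; rewrite inE enum_rankK_in // => /exists_inP[s sS si].
exists s => //; apply/hasP; exists (candidate i) => //.
by apply/map_f; rewrite mem_enum.
Qed.

Lemma candidates_rule (x : {set 'I_#|candidates R|}) :
  branching_rule R [seq candidate i | i <- enum x].
Proof.
have full_closed : candidate_closed R
    [set c : clause G |
      (c != set0) && (clause_vertices c \subset sub_vertices R)].
  rewrite /candidate_closed inE eqxx /=.
  have fR s : clause_vertices (full_clause R s) \subset sub_vertices R.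
    by apply/subsetP => _ /imsetP[l lF ->]; move: lF; rewrite inE => /andP[].
  apply/forall_inP => s _; rewrite inE fR andbT implybb /=.
  apply/forall_inP => c _; rewrite inE; apply/implyP => -> /=.
  apply: subset_trans (fR s); apply: imsetS; exact: subsetIr.
move=> _ /mapP[i _ ->].
have iC : candidate i \in candidates R := enum_valP i.
have := subsetP (bigcap_inf _ full_closed) _ iC.
by rewrite inE => /andP.
Qed.

(** Each clause is replaced by its common clause. Several clauses may have the
    same one, and clauses that no maximum independent set satisfies are
    dropped; both only decrease the sum. *)
Lemma rule_dominated (D : seq (clause G)) (gamma : K) :
  monotone_measure rho -> 1 <= gamma ->
  branching_rule R D -> valid_rule R D ->
  exists2 x : {set 'I_#|candidates R|},
    \bigcup_(i in x) covered i = [set: 'I_#|mis_groups R|]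
  & \sum_(i in x) weight rho gamma i <= \sum_(c <- D) gamma `^ (- drho rho c).
Proof.
move=> mono g1 DR valid.
pose clause_at (j : 'I_(size D)) : clause G := nth set0 D j.
pose x := [set i : 'I_#|candidates R| | 
  [exists j : 'I_(size D), candidate i == common_clause R (clause_at j)]].
exists x.
  apply/setP => j; rewrite [RHS]inE.
  have [s sS /hasP[c cD sc]] := valid _ (enum_valP j).
  have sM : s \in cover (mis_groups R).
    by apply/bigcupP; exists (enum_val j); rewrite // enum_valP.
  have [c0 cR] := DR _ cD.
  have cC := common_clause_candidate c0 cR sM sc.
  apply/bigcupP; exists (enum_rank_in cC (common_clause R c)).
    rewrite inE; apply/existsP.
    have lt : (index c D < size D)%N by rewrite index_mem.
    exists (Ordinal lt).
    by rewrite /candidate /clause_at enum_rankK_in //= nth_index.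
  rewrite inE; apply/exists_inP; exists s => //.
  by rewrite /candidate enum_rankK_in //; exact: common_clause_satisfied.
rewrite (big_nth set0) big_mkord.
(* Each candidate is charged to the clauses of which it is the common clause;
   a clause is charged at most once. *)
pose charged (i : 'I_#|candidates R|) : {set 'I_(size D)} :=
  [set j : 'I_(size D) | candidate i == common_clause R (clause_at j)].
apply: (@le_trans _ _
  (\sum_(i in x) \sum_(j in charged i) gamma `^ (- drho rho (clause_at j)))).
  apply: ler_sum => i; rewrite inE => /existsP[j ij].
  rewrite (bigD1 j) /=; last by rewrite inE.
  rewrite -[leLHS]addr0; apply: lerD; last first.
    by apply: sumr_ge0 => ? _; exact: powR_ge0.
  rewrite /weight; apply: ler_powR => //; rewrite lerN2; apply: drho_mono => //.
  rewrite (eqP ij); apply: common_clause_sub.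
  by have [] := DR _ (mem_nth (set0 : clause G) (ltn_ord j)).
rewrite (exchange_big_dep predT) //=; apply: ler_sum => j _.
set S := (X in X <= _).
have [i /andP[ix ij]|none] := pickP [pred i | (i \in x) && (j \in charged i)];
  last first.
  by rewrite /S big_pred0 // powR_ge0.
rewrite /S (big_pred1 i) // => i' /=.
apply/idP/eqP => [/andP[_]|->]; last exact/andP.
by move: ij; rewrite !inE => /eqP <- /eqP/enum_val_inj.
Qed.

End Rules.

(** * The bisection theorem *)

Local Open Scope classical_set_scope.

Theorem theorem3p7 (K : realType) :
  exists p : program,
  forall (rho : sgraph -> K) (G : sgraph) (R : subgraph G),
    (exists gamma x, @feasible K rho G R gamma x) ->
    exists gamma_opt : K,
      [/\ optimal_value rho R gamma_opt,
          monotone_measure rho ->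
            smallest_branching_complexity rho R gamma_opt
        & exists time : K -> K,
            time =O_ (0^'+) (fun epsilon : K => ln epsilon^-1)
            /\ forall oracle : K -> {set 'I_#|candidates R|},
                 wmsc_oracle (@covered G R) (@weight K rho G R) oracle ->
                 forall epsilon : K, 0 < epsilon ->
                 exists (t : nat) (out : K),
                   [/\ outputs (@weight K rho G R) oracle p epsilon t out,
                       t%:R <= time epsilon
                     & `|out - gamma_opt| <= epsilon]].
Proof.
exists threshold_search => rho G R feas.
pose d (i : 'I_#|candidates R|) := drho rho (candidate i).
have groups_gt0 : (0 < #|'I_#|mis_groups R| |)%N.
  by rewrite card_ord mis_groups_gt0.
have [g attained gmin] :=
  balanced_has_min (feas : exists gamma x, balanced (@covered G R) d gamma x).
have g1 : 1 <= g := opt_ge1 attained.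
have g0 : 0 < g by exact: lt_le_trans g1.
exists g; split; first by split.
- move=> mono; split.
    case: attained => x [e cx _]; exists [seq candidate i | i <- enum x].
    split; [exact: candidates_rule|exact: covered_valid|split=> //].
    by apply/branching_complexityE => //; rewrite big_map big_enum.
  move=> D g' DR valid [g'1 /branching_complexityE e].
  have [x cx le] := rule_dominated mono g'1 DR valid.
  apply: (light_ge_opt groups_gt0 gmin cx g'1).
  by rewrite -(e (lt_le_trans ltr01 g'1)).
- pose N := Num.bound g.
  exists (fun epsilon =>
    (search_cost #|candidates R| N (halvings (2 * g) epsilon))%:R); split.
    by apply: affine_halvings_bigO; lra.
  move=> oracle oracleP epsilon e0.
  have [|||t [s [run le close]]] := @runs_threshold_search K _
      (@weight K rho G R) oracle g epsilon N (halvings (2 * g) epsilon) e0 g1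
      (oracle1 groups_gt0 attained gmin oracleP).
  + move=> og gamma; exact: (oracle_gt1 groups_gt0 attained gmin oracleP og).
  + exact/ltW/upper_nthrootP.
  + by apply: halvingsP => //; rewrite mulr_gt0.
  exists t, (reg s 0); split=> //; first by exists s.
  by rewrite ler_nat.
Qed.
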